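(* Let $(M,g,q)$ be a four-dimensional Riemannian manifold with circulant metric $g$ (given by functions $A,B,C$) and circulant structure $q$ as defined in the context, and let $\nabla$ be the Riemannian connection of $g$. Then $q$ is parallel with respect to $\nabla$ (i.e. $\nabla q=0$) if and only if $$\mathrm{grad}\,A=(\mathrm{grad}\,C)\,q^{2},\qquad 2\,\mathrm{grad}\,B=(\mathrm{grad}\,C)(q+q^{3}).$$
   Context: Setting: $M$ is a four-dimensional smooth manifold with a Riemannian metric $g$ and an endomorphism field $q$ of the tangent bundle such that near every point there are local coordinates $(X^1,X^2,X^3,X^4)$ in which $$(g_{ij})=\begin{pmatrix} A & B & C & B\\ B & A & B & C\\ C & B & A & B\\ B & C & B & A\end{pmatrix},$$ where $A,B,C$ are smooth functions with $0<B<C<A$ (this makes $g$ positive definite), and $q$ has the constant matrix $$(q_i^s)=\begin{pmatrix}0&1&0&0\\0&0&1&0\\0&0&0&1\\1&0&0&0\end{pmatrix},$$ so that for a tangent vector with coordinates $x=(x^1,x^2,x^3,x^4)$ one has $qx=(x^2,x^3,x^4,x^1)$. In particular $q^4=\mathrm{id}$ and $q^2\neq\pm\mathrm{id}$. Such a manifold is denoted $(M,g,q)$. $\nabla$ is the Riemannian (Levi-Civita) connection of $g$. The gradients are the row vectors of partial derivatives in these coordinates: $\mathrm{grad}\,A=(A_1,A_2,A_3,A_4)$ with $A_i=\partial A/\partial X^i$, and similarly for $B$ and $C$; expressions such as $(\mathrm{grad}\,C)q^2$ denote the product of a row vector with a power of the matrix $(q_i^s)=\begin{pmatrix}0&1&0&0\\0&0&1&0\\0&0&0&1\\1&0&0&0\end{pmatrix}$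 of $q$. The identities are required at every point, in these coordinates. Written out in components, they read $A_1=C_3$, $A_2=C_4$, $A_3=C_1$, $A_4=C_2$, $2B_1=2B_3=C_2+C_4$, $2B_2=2B_4=C_1+C_3$. *)

(* Defs.v *)
From mathcomp Require Import all_boot all_order all_algebra.
From mathcomp Require Import all_classical all_reals all_analysis.
Import Order.TTheory GRing.Theory Num.Theory.
Import numFieldNormedType.Exports.

Set Implicit Arguments.
Unset Strict Implicit.
Unset Printing Implicit Defensive.

Local Open Scope classical_set_scope.
Local Open Scope ring_scope.

(* Smooth manifolds are given by an atlas, and tensor fields and affine
   connections by their components in the charts of the atlas, subject to the
   usual transformation laws.  Points of coordinate space are row vectors;
   components of tangent vectors are column vectors, so an endomorphism with
   matrix q sends the tangent vector v to q *m v. *)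

Section Calculus.
Variables (R : realType) (n : nat).

Definition partial (V : normedModType R) (i : 'I_n) (f : 'rV[R]_n -> V)
  : 'rV[R]_n -> V := fun x => 'D_(delta_mx 0 i) f x.

Fixpoint iter_partial (V : normedModType R) (s : seq 'I_n)
    (f : 'rV[R]_n -> V) : 'rV[R]_n -> V :=
  if s is i :: s' then partial i (iter_partial s' f) else f.

(* C^oo on U, meant for open U: infinitely often (Frechet) differentiable. *)
Definition smooth_on (V : normedModType R) (U : set 'rV[R]_n)
    (f : 'rV[R]_n -> V) :=
  forall (s : seq 'I_n) (x : 'rV[R]_n), U x ->
    differentiable (iter_partial s f) x.

Definition grad (f : 'rV[R]_n -> R) (x : 'rV[R]_n) : 'rV[R]_n :=
  \row_i partial i (f : 'rV[R]_n -> R^o) x.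

(* The library's jacobian acts on row vectors from the right; its transpose
   has the entry (a, i) equal to d_i f^a. *)
Definition jac (f : 'rV[R]_n -> 'rV[R]_n) (x : 'rV[R]_n) : 'M[R]_n :=
  (jacobian f x)^T.

End Calculus.

Section Manifold.
Variables (R : realType) (n : nat) (M : topologicalType).

Record chart := Chart {
  chart_dom : set M;
  chart_cod : set 'rV[R]_n;
  to_coord : M -> 'rV[R]_n;
  of_coord : 'rV[R]_n -> M;
  open_dom : open chart_dom;
  open_cod : open chart_cod;
  to_coord_cod : forall p, chart_dom p -> chart_cod (to_coord p);
  of_coord_dom : forall x, chart_cod x -> chart_dom (of_coord x);
  to_coordK : forall p, chart_dom p -> of_coord (to_coord p) = p;
  of_coordK : forall x, chart_cod x -> to_coord (of_coord x) = x;
  continuous_to_coord : {within chart_dom, continuous to_coord};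
  continuous_of_coord : {within chart_cod, continuous of_coord} }.

Definition trans (c d : chart) : 'rV[R]_n -> 'rV[R]_n :=
  fun x => to_coord d (of_coord c x).

Definition trans_dom (c d : chart) : set 'rV[R]_n :=
  [set x | chart_cod c x /\ chart_dom d (of_coord c x)].

(* The atlas need not be maximal. *)
Record smooth_manifold := SmoothManifold {
  atlas : set chart;
  manifold_hausdorff : hausdorff_space M;
  manifold_second_countable : @second_countable M;
  atlas_cover : forall p : M, exists2 c, atlas c & chart_dom c p;
  smooth_trans : forall c d, atlas c -> atlas d ->
        smooth_on (trans_dom c d) (trans c d) }.

Variable S : smooth_manifold.

Record riemannian_metric := RiemannianMetric {
  metric :> chart -> 'rV[R]_n -> 'M[R]_n;
  smooth_metric : forall c, atlas S c -> smooth_on (chart_cod c) (metric c);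
  metric_sym : forall c x, atlas S c -> chart_cod c x -> (metric c x)^T = metric c x;
  metric_posdef : forall c x (v : 'cV[R]_n), atlas S c -> chart_cod c x -> v != 0 ->
        0 < (v^T *m metric c x *m v) 0 0;
  metric_trans : forall c d x, atlas S c -> atlas S d -> trans_dom c d x ->
        metric c x = (jac (trans c d) x)^T *m metric d (trans c d x)
                       *m jac (trans c d) x }.

Record endomorphism_field := EndomorphismField {
  endo :> chart -> 'rV[R]_n -> 'M[R]_n;
  smooth_endo : forall c, atlas S c -> smooth_on (chart_cod c) (endo c);
  endo_trans : forall c d x, atlas S c -> atlas S d -> trans_dom c d x ->
        jac (trans c d) x *m endo c x
        = endo d (trans c d x) *m jac (trans c d) x }.

(* christoffel c i x has the entry (k, j) equal to Gamma^k_{ij}, that is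
   nabla_{d_i} d_j = Gamma^k_{ij} d_k.  In components the last law reads
   J^a_k Gamma^k_{ij} = J^b_i Gamma'^a_{be} J^e_j + d_i J^a_j. *)
Record affine_connection := AffineConnection {
  christoffel :> chart -> 'I_n -> 'rV[R]_n -> 'M[R]_n;
  smooth_christoffel : forall c i, atlas S c -> smooth_on (chart_cod c) (christoffel c i);
  christoffel_trans : forall c d i x, atlas S c -> atlas S d -> trans_dom c d x ->
        jac (trans c d) x *m christoffel c i x
        = \sum_b jac (trans c d) x b i *:
            (christoffel d b (trans c d x) *m jac (trans c d) x)
          + partial i (jac (trans c d)) x }.

Definition torsion_free (nabla : affine_connection) :=
  forall c x i j k, atlas S c -> chart_cod c x ->
    nabla c i x k j = nabla c j x k i.

(* nabla_i g_{jk}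
   = d_i g_{jk} - Gamma^l_{ij} g_{lk} - Gamma^l_{ik} g_{jl} *)
Definition cov_deriv_metric (nabla : affine_connection)
    (g : riemannian_metric) (c : chart) (i : 'I_n) (x : 'rV[R]_n) : 'M[R]_n :=
  partial i (g c) x - (nabla c i x)^T *m g c x - g c x *m nabla c i x.

(* nabla_i q^k_j = d_i q^k_j + Gamma^k_{il} q^l_j - Gamma^l_{ij} q^k_l *)
Definition cov_deriv_endo (nabla : affine_connection)
    (q : endomorphism_field) (c : chart) (i : 'I_n) (x : 'rV[R]_n) : 'M[R]_n :=
  partial i (q c) x + nabla c i x *m q c x - q c x *m nabla c i x.

Definition levi_civita (g : riemannian_metric) (nabla : affine_connection) :=
  torsion_free nabla /\
  forall c i x, atlas S c -> chart_cod c x -> cov_deriv_metric nabla g c i x = 0.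

Definition parallel (nabla : affine_connection) (q : endomorphism_field) :=
  forall c i x, atlas S c -> chart_cod c x -> cov_deriv_endo nabla q c i x = 0.

End Manifold.

Section Circulant.
Variable R : realType.

Definition circulant4 (s : seq R) : 'M[R]_4 :=
  \matrix_(i < 4, j < 4) s`_((j + 4 - i) %% 4).

Definition circ_metric (a b c : R) : 'M[R]_4 := circulant4 [:: a; b; c; b].

Definition circ_q : 'M[R]_4 := circulant4 [:: 0; 1; 0; 0].

Record circulant_chart (M : topologicalType) (S : smooth_manifold R 4 M)
    (g : riemannian_metric S) (q : endomorphism_field S) (c : chart R 4 M)
    (A B C : 'rV[R]_4 -> R) : Prop := CirculantChart {
  circ_atlas : atlas S c;
  smooth_circA : smooth_on (chart_cod c) (A : 'rV[R]_4 -> R^o);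
  smooth_circB : smooth_on (chart_cod c) (B : 'rV[R]_4 -> R^o);
  smooth_circC : smooth_on (chart_cod c) (C : 'rV[R]_4 -> R^o);
  circ_lt : forall x, chart_cod c x -> 0 < B x /\ B x < C x /\ C x < A x;
  circ_metricE : forall x, chart_cod c x -> g c x = circ_metric (A x) (B x) (C x);
  circ_qE : forall x, chart_cod c x -> q c x = circ_q }.

End Circulant.

(* Main.v *)
Require Import Defs.
From mathcomp Require Import all_boot all_order all_algebra.
From mathcomp Require Import all_classical all_reals all_analysis.
From mathcomp Require Import ring lra.
Import Order.TTheory GRing.Theory Num.Theory.
Import numFieldNormedType.Exports.

Local Open Scope classical_set_scope.
Local Open Scope ring_scope.

(* In a chart where g and q are circulant, q is constant, so nabla q = 0 says
   that each Gamma_i commutes with q.  As g is an invertible matrix commuting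
   with q, this means that H_i = g Gamma_i is circulant.  Since H_i is also
   symmetric under the exchange of i with its second lower index, it is then
   (H_i)_{kj} = h(i + j - k) for one function h on Z/4, and
   d_i g = H_i^T + H_i turns into d_i A = 2 h(i), d_i C = 2 h(i + 2),
   d_i B = h(i - 1) + h(i + 1), which is the gradient condition.  Conversely the
   gradient condition provides h, and the Koszul formula recovers H_i from it.
   The covariant derivative of q being a tensor, it vanishes in every chart of
   the atlas as soon as it does in the circulant ones. *)

Set Implicit Arguments.
Unset Strict Implicit.

(** * Leibniz rule for matrix products, Jacobians and the chain rule *)

Lemma is_derive_mulmx (R : realFieldType) (V : normedModType R) (m n p : nat)
    (F : V -> 'M[R]_(m, n)) (G : V -> 'M[R]_(n, p)) (t v : V) :
  derivable F t v -> derivable G t v ->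
  is_derive t v (fun x => F x *m G x) ('D_v F t *m G t + F t *m 'D_v G t).
Proof.
move=> dF dG.
have [dFe dGe] := ((derivable_mxP F t v).1 dF, (derivable_mxP G t v).1 dG).
have FGE i j : (fun x => (F x *m G x) i j)
    = \sum_k ((fun x => F x i k : R^o) * (fun x => G x k j : R^o)).
  by apply/funext => x; rewrite fct_sumE !mxE.
have dFG i j k :
    derivable ((fun x => F x i k : R^o) * (fun x => G x k j : R^o)) t v.
  exact: derivableM.
have dFGmx : derivable (fun x => F x *m G x) t v.
  by apply/derivable_mxP => i j; rewrite FGE; exact: derivable_sum.
apply: DeriveDef => //; rewrite !derive_mx//.
apply/matrixP => i j; rewrite !mxE FGE derive_sum// -big_split.
apply: eq_bigr => k _; rewrite deriveM// !mxE addrC.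
by congr (_ + _); rewrite /GRing.scale /= mulrC.
Qed.

Section Jacobian.
Variables (R : realType) (n : nat).
Implicit Types (U : set 'rV[R]_n) (f : 'rV[R]_n -> 'rV[R]_n) (x : 'rV[R]_n).

Lemma jacE f x i a : differentiable f x -> jac f x a i = partial i f x 0 a.
Proof.
by move=> df; rewrite /partial deriveEjacobian// -rowE !mxE.
Qed.

Lemma diff_delta f x i : differentiable f x ->
  'd f x (delta_mx 0 i) = \sum_a jac f x a i *: delta_mx 0 a.
Proof.
move=> df; rewrite [LHS]row_sum_delta; apply: eq_bigr => a _.
by rewrite jacE// /partial deriveE.
Qed.

Lemma derivable_jac U f x v : open U -> smooth_on U f -> U x ->
  derivable (jac f) x v.
Proof.
move=> oU sf Ux; apply/derivable_mxP => a i.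
(* [jacE] needs differentiability, which holds only on [U], so the entry agrees with a partial
   derivative merely near [x]. *)
apply: (@near_eq_derivable _ _ _ (fun y => partial i f y 0 a)).
  near=> y; rewrite jacE//; apply: (sf [::]); near: y.
  exact: open_nbhs_nbhs.
apply: (derivable_mxP (partial i f) x v).1.
by apply: diff_derivable; exact: (sf [:: i]).
Unshelve. all: by end_near. Qed.

Lemma partial_comp (V : normedModType R) (F : 'rV[R]_n -> V) f x i :
  differentiable f x -> differentiable F (f x) ->
  partial i (F \o f) x = \sum_a jac f x a i *: partial a F (f x).
Proof.
move=> df dF; rewrite /partial deriveE; last exact: differentiable_comp.
rewrite diff_comp//= diff_delta// linear_sum.
by apply: eq_bigr => a _; rewrite linearZ deriveE.
Qed.

End Jacobian.

(** * Change of charts *)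

Section Transition.
Variables (R : realType) (n : nat) (M : topologicalType).
Variable S : smooth_manifold R n M.
Implicit Types (c d : chart R n M) (x : 'rV[R]_n).

Lemma open_trans_dom c d : open (trans_dom c d).
Proof.
have oc := @open_cod _ _ _ c.
have := @continuous_of_coord _ _ _ c; rewrite continuous_open_subspace//.
by move=> /(continuous_inP _ oc)/(_ _ (@open_dom _ _ _ d)).
Qed.

(** Each column [v] of [X] satisfies [v^T g v = 0], so positive definiteness kills it. *)
Lemma metric_mul_inj (g : riemannian_metric S) c x (X : 'M[R]_n) :
  atlas S c -> chart_cod c x -> g c x *m X = 0 -> X = 0.
Proof.
move=> Sc cx gX; apply/matrixP => i j; rewrite [RHS]mxE.
have [Xj0|Xj0] := eqVneq (col j X) 0.
  by move/matrixP/(_ i 0): Xj0; rewrite !mxE.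
have := @metric_posdef _ _ _ _ g _ _ _ Sc cx Xj0.
by rewrite -mulmxA {2}colE (mulmxA (g c x)) gX mul0mx mulmx0 mxE ltxx.
Qed.

(** Injectivity passes from [g c = J^T (g d) J] to the factor [J], without inverting the transition
    map. *)
Lemma jac_trans_mul_inj (g : riemannian_metric S) c d x (X : 'M[R]_n) :
  atlas S c -> atlas S d -> trans_dom c d x ->
  jac (trans c d) x *m X = 0 -> X = 0.
Proof.
move=> Sc Sd cdx JX; apply: (metric_mul_inj (g := g) Sc cdx.1).
by rewrite (metric_trans g Sc Sd cdx) -mulmxA JX mulmx0.
Qed.

(** Tensoriality: the inhomogeneous terms [d_i J] of the Christoffel law are exactly those produced
    by differentiating [J q = q' J]. *)
Lemma cov_deriv_endo_trans (nabla : affine_connection S)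
    (q : endomorphism_field S) c d x i :
  atlas S c -> atlas S d -> trans_dom c d x ->
  jac (trans c d) x *m cov_deriv_endo nabla q c i x
  = (\sum_b jac (trans c d) x b i *:
       cov_deriv_endo nabla q d b (trans c d x)) *m jac (trans c d) x.
Proof.
move=> Sc Sd cdx.
set J := jac (trans c d); set y := trans c d x.
have sT := smooth_trans Sc Sd.
have oU : open (trans_dom c d) by exact: open_trans_dom.
have dT : differentiable (trans c d) x by exact: (sT [::]).
have dy : chart_cod d y by apply: to_coord_cod; exact: cdx.2.
have dq : differentiable (q d) y by exact: (smooth_endo q Sd [::] dy).
have dJ : derivable J x (delta_mx 0 i) by apply: derivable_jac oU sT cdx.
have dqc : derivable (q c) x (delta_mx 0 i).
  by apply: diff_derivable; exact: (smooth_endo q Sc [::] cdx.1).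
have dqT : derivable (q d \o trans c d) x (delta_mx 0 i).
  by apply: diff_derivable; exact: differentiable_comp.
(* The law [J q = q' J] holds on the open set [trans_dom c d], so both sides may be differentiated
   at [x]. *)
have : partial i J x *m q c x + J x *m partial i (q c) x
     = partial i (q d \o trans c d) x *m J x + q d y *m partial i J x.
  rewrite -[LHS](@derive_val _ _ _ _ _ _ _ (is_derive_mulmx dJ dqc)).
  rewrite -[RHS](@derive_val _ _ _ _ _ _ _ (is_derive_mulmx dqT dJ)).
  apply: near_eq_derive; near=> z; apply: (endo_trans q Sc Sd).
  by near: z; exact: open_nbhs_nbhs.
rewrite [partial i (q d \o _) x]partial_comp// -/J -/y => Leibniz.
have tG := christoffel_trans nabla i Sc Sd cdx.
have tq := endo_trans q Sc Sd cdx.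
rewrite -/J -/y in tG tq Leibniz *.
pose G := \sum_b J x b i *: nabla d b y.
have -> : \sum_b J x b i *: cov_deriv_endo nabla q d b y
    = \sum_b J x b i *: partial b (q d) y + G *m q d y - q d y *m G.
  rewrite mulmx_suml mulmx_sumr -big_split -sumrB /=; apply: eq_bigr => b _.
  by rewrite /cov_deriv_endo -scalemxAl -scalemxAr -scalerDr -scalerBr.
have {}tG : J x *m nabla c i x = G *m J x + partial i J x.
  rewrite tG mulmx_suml; congr (_ + _).
  by apply: eq_bigr => b _; rewrite scalemxAl.
(* Moving [J] to the right leaves [J d_i q + (d_i J) q - q' d_i J], which [Leibniz] turns into
   [d_i (q' o T) J], with [T] the transition map. *)
rewrite /cov_deriv_endo mulmxBr mulmxDr !mulmxA tG tq -(mulmxA (q d y)) tG.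
rewrite mulmxBl !mulmxDl mulmxDr -!mulmxA tq opprD addrA addrAC; congr (_ - _).
rewrite [G *m _ + _]addrC [X in X - _]addrA [J x *m _ + _]addrC Leibniz.
by rewrite addrAC addrK.
Unshelve. all: by end_near. Qed.

End Transition.

(** * Circulant matrices, with indices in Z/4 *)

Section CirculantAlgebra.
Variable R : realType.
Implicit Types (i j k : 'I_4) (X : 'M[R]_4).

(** The truncated [(j + 4 - i) %% 4] is subtraction in the ring ['I_4], so index arithmetic becomes
    ring arithmetic. *)
Lemma circulant4E (s : seq R) i j : circulant4 s i j = s`_(j - i)%R.
Proof.
by rewrite mxE; case: i j => [[|[|[|[|//]]]] ?] [[|[|[|[|//]]]] ?].
Qed.

Lemma circ_q_coef i j : circ_q R i j = (j == i + 1)%:R.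
Proof.
by rewrite circulant4E; case: i j => [[|[|[|[|//]]]] ?] [[|[|[|[|//]]]] ?].
Qed.

Lemma mul_circ_q X i j : (circ_q R *m X) i j = X (i + 1) j.
Proof.
rewrite mxE (bigD1 (i + 1))//= circ_q_coef eqxx mul1r big1 ?addr0// => k ki.
by rewrite circ_q_coef (negbTE ki) mul0r.
Qed.

Lemma mul_mx_circ_q m (X : 'M[R]_(m, 4)) (i : 'I_m) j :
  (X *m circ_q R) i j = X i (j - 1).
Proof.
rewrite mxE (bigD1 (j - 1))//= circ_q_coef subrK eqxx mulr1 big1 ?addr0//.
by move=> k kj; rewrite circ_q_coef -subr_eq eq_sym (negbTE kj) mulr0.
Qed.

Lemma circ_metric_comm a b c :
  circ_metric a b c *m circ_q R = circ_q R *m circ_metric a b c.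
Proof.
apply/matrixP => i j; rewrite mul_circ_q mul_mx_circ_q !circulant4E.
by rewrite opprD addrA addrAC.
Qed.

Lemma comm_circ_qP X :
  (forall i j, X (i + 1) (j + 1) = X i j) <-> X *m circ_q R = circ_q R *m X.
Proof.
split=> [Xs|/matrixP XC i j].
  apply/matrixP => i j; rewrite mul_circ_q mul_mx_circ_q.
  by rewrite -Xs subrK.
by have := XC i (j + 1); rewrite mul_circ_q mul_mx_circ_q addrK.
Qed.

(** This identity and the next three hold because 4 = 0 in ['I_4], which [ring] does not use. *)
Let addr22 i : i + 2 + 2 = i.
Proof. by case: i => [[|[|[|[|//]]]] ?]; apply/val_inj. Qed.

Let subr2 i : i - 2 = i + 2.
Proof. by case: i => [[|[|[|[|//]]]] ?]; apply/val_inj. Qed.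

Let addr12 i : i + 1 + 2 = i - 1.
Proof. by case: i => [[|[|[|[|//]]]] ?]; apply/val_inj. Qed.

Let subr1D2 i : i - 1 + 2 = i + 1.
Proof. by case: i => [[|[|[|[|//]]]] ?]; apply/val_inj. Qed.

Lemma gradient_conditionsE (a b c : 'rV[R]_4) :
  a = c *m circ_q R ^+ 2 /\ 2 *: b = c *m (circ_q R + circ_q R ^+ 3) <->
  forall i, a 0 i = c 0 (i + 2) /\ 2 * b 0 i = c 0 (i - 1) + c 0 (i + 1).
Proof.
have c2 i : (c *m circ_q R ^+ 2) 0 i = c 0 (i + 2).
  rewrite expr2 [X in c *m X]/GRing.mul/= mulmxA !mul_mx_circ_q.
  by rewrite -addrA -opprD subr2.
have c3 i : (c *m (circ_q R + circ_q R ^+ 3)) 0 i = c 0 (i - 1) + c 0 (i + 1).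
  rewrite mulmxDr exprSr [X in _ + c *m X]/GRing.mul/= mulmxA mxE.
  by rewrite !mul_mx_circ_q c2 subr1D2.
split=> [[ac bc] i|abc].
  by rewrite ac c2; split=> //; rewrite -c3 -bc mxE.
split; apply/rowP => i; first by rewrite c2; case: (abc i).
by rewrite c3 mxE; case: (abc i).
Qed.

(* [H i k j] stands for the lowered Christoffel symbol [Gamma_{kij}]; the metric
   equation becomes [d_i g_s = h (i - s) + h (i + s)]. *)
Lemma lowered_christoffel_circulant (H : 'I_4 -> 'M[R]_4) (a b c : 'rV[R]_4) :
  (forall i k j, H i k j = H j k i) ->
  (forall i, (H i)^T + H i = circ_metric (a 0 i) (b 0 i) (c 0 i)) ->
  (forall i k j, H i (k + 1) (j + 1) = H i k j) <->
  forall i, a 0 i = c 0 (i + 2) /\ 2 * b 0 i = c 0 (i - 1) + c 0 (i + 1).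
Proof.
move=> Hsym Hg; pose d i (s : 'I_4) : R := [:: a 0 i; b 0 i; c 0 i; b 0 i]`_s.
have {}Hg i k j : H i j k + H i k j = d i (j - k).
  by move/matrixP/(_ k j): (Hg i); rewrite circulant4E !mxE.
split=> [Hshift i|abc].
  have shift i' k j s : H i' (k + s) (j + s) = H i' k j.
    have -> : s = (val s)%:R by rewrite Zp_nat valZpK.
    by elim: (val s) => [|m IH]; rewrite ?addr0// -natr1 !addrA Hshift.
  (* Forced by [H i k j = h (i + j - k)] at [i = j = 0]. *)
  pose h s := H 0 (- s) 0.
  have Hh i' k j : H i' k j = h (i' + j - k).
    (* Shift [j] to 0, exchange it with [i'] by [Hsym], then shift [i'] to 0. *)
    have := shift i' (k - j) 0 j; rewrite subrK add0r [RHS]Hsym => ->.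
    have := shift 0 (k - j - i') 0 i'; rewrite subrK add0r => ->.
    by rewrite /h opprB opprD addrA addrAC.
  have dh i' s : d i' s = h (i' - s) + h (i' + s).
    have := Hg i' 0 s; rewrite subr0 !Hh => <-.
    by rewrite addr0 subr0.
  have [dA dB dC] :
    [/\ d i 0 = a 0 i, d i 1 = b 0 i & forall j, d j 2 = c 0 j] by [].
  rewrite -dA -dB -!dC !dh !subr0 !addr0 !addrK.
  rewrite !subr2 addr22 addr12 subr1D2.
  by split=> //; ring.
(* Forced by the case [s = 0] of [dh], namely [a_i = 2 h(i)]. *)
pose h s := a 0 s / 2.
have dh i s : d i s = h (i - s) + h (i + s).
  (* The conditions at [i - 1], [i + 1] and [i + 2] rewrite the values of [h] as halves of entries
     of [c]. *)
  have [ai bi] := abc i; have [am _] := abc (i - 1).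
  have [ap _] := abc (i + 1); have [a2 _] := abc (i + 2).
  rewrite addr22 in a2; rewrite addr12 in ap; rewrite subr1D2 in am.
  case: s => [[|[|[|[|//]]]] ss].
  - have -> : Ordinal ss = 0 by exact/val_inj.
    by rewrite /d /h /= subr0 addr0; lra.
  - have -> : Ordinal ss = 1 by exact/val_inj.
    by rewrite /d /h /=; lra.
  - have -> : Ordinal ss = 2 by exact/val_inj.
    by rewrite /d /h /= subr2; lra.
  - have -> : Ordinal ss = - 1 by exact/val_inj.
    by rewrite /d /h /= opprK; lra.
(* The Koszul formula. *)
have Hh i k j : H i k j = h (i + j - k).
  have := Hg i k j; have := Hg j i k; have := Hg k i j.
  rewrite !dh (Hsym k j i) (Hsym k i j) (Hsym j k i).
  have -> : k - (j - i) = i + k - j by ring.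
  have -> : j - (k - i) = i + j - k by ring.
  have -> : i - (j - k) = i + k - j by ring.
  have -> : k + (j - i) = j + k - i by ring.
  have -> : j + (k - i) = j + k - i by ring.
  have -> : i + (j - k) = i + j - k by ring.
  (* Adding the equations for [i] and [j] and subtracting that for [k] leaves
     [2 H i k j = 2 h (i + j - k)]. *)
  lra.
move=> i k j; rewrite !Hh; congr h; ring.
Qed.

End CirculantAlgebra.

(** * The equivalence inside one circulant chart *)

Section CirculantChart.
Variables (R : realType) (M : topologicalType) (S : smooth_manifold R 4 M).
Variables (g : riemannian_metric S) (q : endomorphism_field S).
Variables (c : chart R 4 M) (A B C : 'rV[R]_4 -> R).
Hypothesis cc : circulant_chart g q c A B C.

Let near_cod x : chart_cod c x -> \forall y \near x, chart_cod c y.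
Proof. by move=> cx; apply: open_nbhs_nbhs; split=> //; exact: open_cod. Qed.

Lemma partial_circ_metric i x : chart_cod c x ->
  partial i (g c) x = circ_metric (grad A x 0 i) (grad B x 0 i) (grad C x 0 i).
Proof.
move=> cx; have Sc := circ_atlas cc.
rewrite /partial derive_mx; last first.
  by apply: diff_derivable; exact: (smooth_metric g Sc [::] cx).
apply/matrixP => k j; rewrite circulant4E !mxE.
have -> : 'D_(delta_mx 0 i) (fun t => g c t k j) x
    = 'D_(delta_mx 0 i) (fun t => [:: A t; B t; C t; B t]`_(j - k)%R : R^o) x.
  apply: near_eq_derive; near=> t.
  by rewrite (circ_metricE cc) ?circulant4E//; near: t; exact: near_cod.
by case: (j - k) => [[|[|[|[|//]]]] ?].
Unshelve. all: by end_near. Qed.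

Lemma partial_circ_q i x : chart_cod c x -> partial i (q c) x = 0.
Proof.
move=> cx; rewrite -(derive_cst (circ_q R) x (delta_mx 0 i)).
apply: near_eq_derive; near=> t.
by rewrite (circ_qE cc)//; near: t; exact: near_cod.
Unshelve. all: by end_near. Qed.

Lemma circulant_chart_parallelP (nabla : affine_connection S) x :
  levi_civita g nabla -> chart_cod c x ->
  (forall i, cov_deriv_endo nabla q c i x = 0) <->
  grad A x = grad C x *m circ_q R ^+ 2 /\
  2 *: grad B x = grad C x *m (circ_q R + circ_q R ^+ 3).
Proof.
move=> [torsion0 metric0] cx; have Sc := circ_atlas cc.
pose H i := g c x *m nabla c i x.
have Hsym i k j : H i k j = H j k i.
  by rewrite !mxE; apply: eq_bigr => l _; rewrite torsion0.
have Hg i : (H i)^T + H i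
    = circ_metric (grad A x 0 i) (grad B x 0 i) (grad C x 0 i).
  (* As [g] is symmetric, [nabla g = 0] reads [d_i g = H_i^T + H_i]. *)
  rewrite -partial_circ_metric// trmx_mul Defs.metric_sym//.
  by have /eqP := metric0 _ i _ Sc cx; rewrite subr_eq0 subr_eq addrC => /eqP.
rewrite gradient_conditionsE -(lowered_christoffel_circulant Hsym Hg).
have covE i : g c x *m cov_deriv_endo nabla q c i x
    = H i *m circ_q R - circ_q R *m H i.
  rewrite /cov_deriv_endo partial_circ_q// add0r (circ_qE cc)// mulmxBr !mulmxA.
  rewrite [in X in _ - X](circ_metricE cc)// circ_metric_comm.
  by rewrite -(circ_metricE cc).
split=> [q0 i|Hshift i].
  by apply/comm_circ_qP/eqP; rewrite -subr_eq0 -covE q0 mulmx0.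
apply: (metric_mul_inj (g := g) Sc cx).
by rewrite covE; apply/eqP; rewrite subr_eq0; apply/eqP/comm_circ_qP/Hshift.
Qed.

End CirculantChart.

Unset Implicit Arguments.

Theorem theorem5p1 (R : realType) (M : topologicalType)
    (S : smooth_manifold R 4 M) (g : riemannian_metric S)
    (q : endomorphism_field S) (nabla : affine_connection S)
    (nabla_LC : levi_civita g nabla)
    (D : set (chart R 4 M)) (A B C : chart R 4 M -> 'rV[R]_4 -> R)
    (D_cover : forall p : M, exists2 c, D c & chart_dom c p)
    (D_circ : forall c, D c -> circulant_chart g q c (A c) (B c) (C c)) :
  parallel nabla q <->
  (forall c x, D c -> chart_cod c x ->
     grad (A c) x = grad (C c) x *m circ_q R ^+ 2 /\
     2 *: grad (B c) x = grad (C c) x *m (circ_q R + circ_q R ^+ 3)).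
Proof.
split=> [q0 c x Dc cx|gradE c i x Sc cx].
  have cc := D_circ c Dc.
  apply/(circulant_chart_parallelP cc nabla_LC cx) => i.
  by apply: q0 => //; exact: circ_atlas cc.
(* [c] is any chart of the atlas, so the point is moved to a circulant chart [d] around it. *)
have [d Dd dx] := D_cover (of_coord c x).
have cd := D_circ d Dd; have Sd := circ_atlas cd.
have cdx : trans_dom c d x by [].
have dy : chart_cod d (trans c d x) by exact: to_coord_cod.
have := gradE d _ Dd dy.
move/(circulant_chart_parallelP cd nabla_LC dy) => q0.
apply: (jac_trans_mul_inj g Sc Sd cdx).
rewrite cov_deriv_endo_trans//.
by rewrite big1 ?mul0mx// => b _; rewrite q0 scaler0.
Qed.
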